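(* For every fixed integer $k\ge 4$ and every $\epsilon>0$ there exist infinitely many graphs $G$ with chromatic number $\chi(G)=k$ and $$m_2(G)\le (1+\epsilon)\frac{(k+1)(k-2)}{2(k-1)}.$$
   Context: The 2-density of a graph $G$ is $m_2(G)=\max\{\frac{e(G')-1}{v(G')-2}: G'\subseteq G,\ v(G')\ge 3\}$, where $e(\cdot),v(\cdot)$ denote numbers of edges and vertices. *)

(* Defs.v *)
From HB Require Import structures.
From mathcomp Require Import all_boot all_order all_algebra.
From mathcomp Require Import reals.
Set Implicit Arguments.
Unset Strict Implicit.
Unset Printing Implicit Defensive.
Import Order.TTheory GRing.Theory Num.Theory.
Local Open Scope ring_scope.

Record sgraph := SGraph {
  vertex :> finType;
  adj : rel vertex;
  adj_sym : symmetric adj;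
  adj_irrefl : irreflexive adj }.

Definition edges (G : sgraph) : {set {set G}} :=
  [set [set p.1; p.2] | p : G * G & adj p.1 p.2].

Definition isomorphic (G H : sgraph) : Prop :=
  exists f : G -> H, bijective f /\ forall x y, adj (f x) (f y) = adj x y.

(* Graphs are counted up to isomorphism. *)
Definition infinitely_many_graphs (P : sgraph -> Prop) : Prop :=
  exists G : nat -> sgraph,
    (forall i j, i <> j -> ~ isomorphic (G i) (G j)) /\ forall i, P (G i).

Definition colorable (G : sgraph) (k : nat) : bool :=
  [exists f : {ffun G -> 'I_k},
    [forall x, forall y, adj x y ==> (f x != f y)]].

Lemma ex_colorable (G : sgraph) : exists k, colorable G k.
Proof.
exists #|G|; apply/existsP; exists [ffun x => enum_rank x].
apply/forallP => x; apply/forallP => y; apply/implyP => xy.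
rewrite !ffunE (inj_eq enum_rank_inj).
by apply: contraTneq xy => ->; rewrite adj_irrefl.
Qed.

Definition chromatic_number (G : sgraph) : nat := ex_minn (ex_colorable G).

(* A pair (V', E') of a vertex set and an edge set; subgraphs need not be
   induced. *)
Definition is_subgraph (G : sgraph) (H : {set G} * {set {set G}}) : bool :=
  (H.2 \subset edges G) && [forall e in H.2, e \subset H.1].

Definition density2 (R : realFieldType) (G : sgraph)
    (H : {set G} * {set {set G}}) : R :=
  (#|H.2|%:R - 1) / (#|H.1|%:R - 2).

(* The maximum is seeded with the value at G itself, which is one of the
   competing subgraphs as soon as G has at least 3 vertices (see m2_max); on
   fewer vertices no subgraph competes and the value is meaningless. Seeding
   with 0 would be wrong for edgeless graphs, whose 2-density is negative. *)
Definition m2 (R : realFieldType) (G : sgraph) : R :=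
  \big[Num.max/density2 R ([set: G], edges G)]_
    (H : {set G} * {set {set G}} | is_subgraph H && (3 <= #|H.1|)%N)
      density2 R H.

Lemma m2_max (R : realFieldType) (G : sgraph) : (3 <= #|G|)%N ->
  (exists H : {set G} * {set {set G}},
     [/\ is_subgraph H, (3 <= #|H.1|)%N & m2 R G = density2 R H]) /\
  (forall H : {set G} * {set {set G}},
     is_subgraph H -> (3 <= #|H.1|)%N -> density2 R H <= m2 R G).
Proof.
move=> G3; split; last first.
  by move=> H sH H3; apply: le_bigmax_cond; rewrite sH.
rewrite /m2; elim/big_ind: _ => [|x y Hx Hy|H /andP[sH H3]].
- exists ([set: G], edges G); split; rewrite ?cardsT //.
  by rewrite /is_subgraph subxx; apply/forall_inP => e _; apply: subsetT.
- by case: (leP x y).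
- by exists H.
Qed.

(* Main.v *)
(** Put n = k - 1 and let c = (n + 2)(n - 1) / (2n) be the target density. The
    graph is built from copies of a sparse gadget whose vertices are arranged in
    layers of n vertices, each a clique with the edge {0, 1} removed; every
    vertex of a layer sends one edge to vertex 0 or 1 of the previous layer, the
    two classes being as equal as possible. If all vertices of a layer avoid a
    common colour in an n-colouring, then the vertices 0 and 1 of this layer
    agree, and their common colour is avoided by the next layer. Attach the
    "ports", which are all vertices of the first layer, vertex 1 of the last
    full layer and all vertices of an additional top layer, an (n - 1)-clique,
    to vertices of one colour a. Then the common colour of 0 and 1 in the last
    full layer is not a, so that only n - 2 colours are left for the top layer:
    no n-colouring of the gadget avoids a on all ports. A layer contributes at
    most c edges per vertex, so the top layer exceeds c by a constant which is
    negligible in a long gadget, while a subgraph that misses a layer saves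
    enough to compensate it.

    The attachments go to a set of roots so large that every n-colouring is
    constant on as many roots as a gadget has vertices; one gadget is added for
    each injection into the roots. A subgraph with at least two roots has
    2-density at most c(1 + eps) because each gadget has at most c(1 + eps)
    edges, attachments included, per vertex; a subgraph with at most one root
    uses at most one attachment per gadget, and there the bound c(|S| - 2) + 1
    on the number of edges inside a gadget suffices. *)
Require Import Defs.
From mathcomp Require Import all_boot all_order all_algebra.
From mathcomp Require Import reals.
From mathcomp Require Import perm zify ring lra.
Import Order.TTheory GRing.Theory Num.Theory.
Set Implicit Arguments.
Unset Strict Implicit.
Unset Printing Implicit Defensive.
Local Open Scope ring_scope.

(** * The target density and edge counts in a single layer *)

Definition dens (R : realFieldType) (n : nat) : R :=
  ((n%:R + 2) * (n%:R - 1)) / (2 * n%:R).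

Section Layer.
Variables (R : realFieldType) (p : nat).
Local Notation n := p.+3.
Local Notation c := (dens R n).

Definition v1 : 'I_n := Ordinal (isT : (1 < n)%N).

(* The two linking classes must both have at most (n + 1) / 2 elements; for
   n = 3 the larger one has to be {0, 1}, otherwise a triangle remains. *)
Definition half_size : nat := n.+1./2.

Definition inner (i j : 'I_n) : bool :=
  (i < j)%N && ((i, j) != (ord0, v1)).

Definition link (j : 'I_n) : 'I_n := if (j < half_size)%N then v1 else ord0.

Definition inner_edges (A : {set 'I_n}) : nat :=
  \sum_(i in A) \sum_(j in A) inner i j.

Definition link_edges (A B : {set 'I_n}) : nat := \sum_(j in A) (link j \in B).

Definition both (A : {set 'I_n}) : bool := (ord0 \in A) && (v1 \in A).

Lemma inner_edgesE (A : {set 'I_n}) :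
  ((inner_edges A + both A).*2 + #|A| = #|A| * #|A|)%N.
Proof.
have splt : (inner_edges A + both A = \sum_(i in A) \sum_(j in A) (i < j))%N.
  have -> : (both A : nat) = (\sum_(i in A) \sum_(j in A) ((i, j) == (ord0, v1)))%N.
    rewrite pair_big_dep /=.
    under eq_bigr => q _ do rewrite -surjective_pairing.
    rewrite -big_mkcondr /= sum1dep_card /both.
    case h: (_ && _).
      rewrite (_ : [set x | _] = [set (ord0, v1)]) ?cards1 //.
      by apply/setP=> q; rewrite !inE; case: eqP => [->|]; rewrite ?andbF //= h.
    apply/esym/eqP; rewrite cards_eq0; apply/eqP/setP=> q; rewrite !inE.
    by case: eqP => [->|]; rewrite ?andbF //= h.
  rewrite -big_split; apply: eq_bigr => i iA; rewrite -big_split.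
  apply: eq_bigr => j jA; rewrite /inner.
  by case: eqP => [[-> ->]|]; rewrite ?andbT ?andbF //= addn0.
rewrite splt -addnn {2}exchange_big /= -!big_split /= -{1}sum1_card -big_split /=.
rewrite -sum_nat_const; apply: eq_bigr => i iA.
rewrite -!big_split /= -sum1_card [RHS](bigD1 i) //= (bigD1 i) //= ltnn.
rewrite addnC addnA !add0n.
congr addn; apply: eq_bigr => j /andP[_ ij].
by move: ij; rewrite -(inj_eq val_inj) /=; case: ltngtP.
Qed.

(** Naming q = 1/n makes the later estimates polynomial in n and q, within reach of [nra]. *)
Lemma dens_inv : exists q : R,
  [/\ n%:R * q = 1, 0 < q & c = (n%:R + 1) / 2 - q].
Proof.
have n0 : n%:R != 0 :> R by rewrite pnatr_eq0.
exists (n%:R^-1); split; [by rewrite divff | by rewrite invr_gt0 ltr0n |].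
rewrite /dens; move: n%:R n0 => N N0.
by field.
Qed.

Lemma inner_edgesR (A : {set 'I_n}) :
  2 * (inner_edges A)%:R = #|A|%:R ^+ 2 - #|A|%:R - 2 * (both A)%:R :> R.
Proof.
have /(congr1 (fun x => x%:R : R)) := inner_edgesE A.
rewrite natrD natrM -mul2n natrM natrD => h; lra.
Qed.

Lemma both_card (A : {set 'I_n}) : both A -> (2 <= #|A|)%N.
Proof.
move=> /andP[A0 A1]; rewrite (cardsD1 ord0) A0 (cardsD1 v1) !inE A1.
by rewrite andbT.
Qed.

Lemma not_both_card (A : {set 'I_n}) : ~~ both A -> (#|A| <= p.+2)%N.
Proof.
move=> nb; rewrite -ltnS -[X in (_ < X)%N]card_ord -cardsT.
by apply: proper_card; rewrite properE subsetT; apply: contra nb => /subsetP h;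
   rewrite /both !h.
Qed.

Lemma card_layer (A : {set 'I_n}) : (#|A| <= n)%N.
Proof. by rewrite -[X in (_ <= X)%N]card_ord max_card. Qed.

(** A full layer with one link per vertex has n(n - 1)/2 - 1 + n = c n edges: equality holds there,
    which is where c comes from. *)
Lemma layer_edges_le (A : {set 'I_n}) :
  (inner_edges A)%:R + #|A|%:R <= c * #|A|%:R.
Proof.
have [q [nq q0 ->]] := dens_inv.
have := inner_edgesR A; have := card_layer A.
have n3 : 3 <= n%:R :> R by rewrite ler_nat.
case: (boolP (both A)) => [/both_card|/not_both_card].
  rewrite -!(ler_nat R) /=; move: #|A|%:R (inner_edges A)%:R n%:R nq n3.
  by move=> m e N *; nra.
rewrite -ltnS -!(ler_nat R) -natr1 /=; have := ler0n R #|A|.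
move: #|A|%:R (inner_edges A)%:R n%:R nq n3 => m e N *.
have : 0 <= m * (N - (m + 1)) by apply: mulr_ge0; lra.
have : 0 <= m * (1 - 2 * q) by apply: mulr_ge0; nra.
nra.
Qed.

(** This is e - 1 <= c (m - 2), the 2-density condition inside one layer. *)
Lemma inner_edges_le (A : {set 'I_n}) : (2 <= #|A|)%N ->
  (inner_edges A)%:R <= c * #|A|%:R - (2 * c - 1).
Proof.
have [q [nq q0 ->]] := dens_inv.
have := inner_edgesR A; have := card_layer A.
have n3 : 3 <= n%:R :> R by rewrite ler_nat.
case: (boolP (both A)) => [_|/not_both_card].
  rewrite -!(ler_nat R) /=; move: #|A|%:R (inner_edges A)%:R n%:R nq n3.
  move=> m e N nq n3 mN eE m2.
  have : 0 <= (m - 2) * (N - m) by apply: mulr_ge0; lra.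
  nra.
rewrite -ltnS -!(ler_nat R) -natr1 /=.
move: #|A|%:R (inner_edges A)%:R n%:R nq n3 => m e N nq n3 mN1 mN eE m2.
have : 0 <= (m - 2) * (N - (m + 1)) by apply: mulr_ge0; lra.
have : 0 <= (m - 2) * (1 - 2 * q) by apply: mulr_ge0; nra.
nra.
Qed.

Lemma dens_gt : 3 / 2 < c.
Proof.
have [q [nq q0 ->]] := dens_inv.
have n3 : 3 <= n%:R :> R by rewrite ler_nat.
nra.
Qed.

Lemma inner_edges1 (A : {set 'I_n}) : (#|A| <= 1)%N -> inner_edges A = 0.
Proof.
by have := inner_edgesE A; case: #|A| => [|[|//]] //; lia.
Qed.

Lemma inner_edges_le1 (A : {set 'I_n}) : (0 < #|A|)%N ->
  (inner_edges A)%:R <= c * #|A|%:R - c.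
Proof.
have c32 := dens_gt; case: (ltnP 1 #|A|) => [A2 _|A1 A0].
  by have := inner_edges_le A2; lra.
by rewrite inner_edges1 //; have -> : #|A| = 1 by [lia]; lra.
Qed.

Lemma inner_edges_both (A : {set 'I_n}) : both A ->
  (inner_edges A)%:R <= c * #|A|%:R - (c + 1).
Proof.
have [q [nq q0 ->]] := dens_inv => bA.
have := inner_edgesR A; have := card_layer A; have := both_card bA.
have n3 : 3 <= n%:R :> R by rewrite ler_nat.
rewrite bA -!(ler_nat R) /=.
move: #|A|%:R (inner_edges A)%:R n%:R nq n3 => m e N nq n3 m2 mN eE.
have : 0 <= (m - 1) * (N - m) by apply: mulr_ge0; lra.
have : 0 <= (m - 1) * (1 - 2 * q) by apply: mulr_ge0; nra.
nra.
Qed.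

Lemma half_size_bounds :
  (2 <= half_size /\ half_size.*2 <= p.+4 /\ p.+3 <= half_size.*2)%N.
Proof.
by rewrite /half_size; have := odd_double_half p.+4; case: odd => /=; lia.
Qed.

Lemma link_edges_card (A B : {set 'I_n}) : (link_edges A B <= #|A|)%N.
Proof. by rewrite -sum1_card; apply: leq_sum => j _; case: (_ \in _). Qed.

Lemma link_edges_setT (A : {set 'I_n}) : link_edges A setT = #|A|.
Proof. by rewrite -sum1_card; apply: eq_bigr => j _; rewrite inE. Qed.

Lemma link_edges0 (A B : {set 'I_n}) :
  ord0 \notin B -> v1 \notin B -> link_edges A B = 0.
Proof.
move=> /negbTE B0 /negbTE B1; apply: big1 => j _; rewrite /link.
by case: ifP; rewrite ?B0 ?B1.
Qed.

(** Only one linking class can reach [B], and k counts its members in [A]. Vertices 0 and 1 both lie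
    in the lower class: if that class counts, missing one of them lowers k; if the upper class
    counts, neither contributes to k. *)
Lemma link_edges_one (A B : {set 'I_n}) : ~~ both B ->
  exists k : nat, [/\ (link_edges A B <= k <= #|A|)%N, (k.*2 <= n.+1)%N,
    (~~ both A -> k.*2 <= n)%N & (both A -> k.+2 <= #|A| \/ k <= half_size)%N].
Proof.
have [b2 [bn nb]] := half_size_bounds.
pose lo := [set j : 'I_n | (j < half_size)%N].
have cardlo : #|lo| = half_size.
  rewrite -sum1dep_card -(@big_ord_widen _ _ _ half_size n (fun=> 1%N));
    by rewrite ?sum1_card ?card_ord //; lia.
have lo0 : ord0 \in lo by rewrite inE (ltn_trans _ b2).
have lo1 : v1 \in lo by rewrite inE.
move=> nB; case: (boolP (v1 \in B)) => B1.
  have B0 : ord0 \in B = false.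
    by apply/negbTE; move: nB; rewrite /both B1 andbT.
  exists #|A :&: lo|; split;
    last by move=> _; right; rewrite -cardlo subset_leq_card ?subsetIr.
  - apply/andP; split; last by rewrite subset_leq_card ?subsetIl.
    rewrite -sum1_card /= (eq_bigl (fun j => (j \in A) && (j \in lo)));
      last by move=> j; rewrite inE.
    rewrite [X in (_ <= X)%N]big_mkcondr /=; apply: leq_sum => j _.
    rewrite /link inE; case: (ltnP j half_size); rewrite ?B0 //.
    by case: (_ \in _).
  - have : (#|A :&: lo| <= half_size)%N.
      by rewrite -cardlo subset_leq_card ?subsetIr.
    lia.
  - move=> nA; have : (#|A :&: lo| < half_size)%N; last by lia.
    rewrite -cardlo proper_card // properE subsetIr; apply: contra nA => /subsetP h.
    by have := h _ lo0; have := h _ lo1; rewrite /both !in_setI => /andP[-> _] /andP[-> _].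
have cardhi : (#|~: lo| = n - half_size)%N.
  by rewrite cardsCs setCK cardlo card_ord.
have hi : (#|A :&: ~: lo| <= n - half_size)%N.
  by rewrite -cardhi subset_leq_card ?subsetIr.
exists #|A :&: ~: lo|; split; [| lia | lia |].
- apply/andP; split; last by rewrite subset_leq_card ?subsetIl.
  rewrite -sum1_card /= (eq_bigl (fun j => (j \in A) && (j \in ~: lo)));
    last by move=> j; rewrite inE.
  rewrite [X in (_ <= X)%N]big_mkcondr /=; apply: leq_sum => j _.
  rewrite /link !inE; case: (ltnP j half_size); rewrite ?(negbTE B1) //.
  by case: (_ \in _).
- move=> /andP[A0 A1]; left.
  rewrite (cardsD1 ord0 A) A0 (cardsD1 v1 (A :\ ord0)) !inE A1 /= !add1n !ltnS.
  apply: subset_leq_card; apply/subsetP => j; rewrite !inE => /andP[-> jb].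
  rewrite andbT; apply/andP; split; apply: contraNneq jb => ->;
    [exact: b2 | exact: ltn_trans b2].
Qed.

(** The saving c - 1 is what [chain_sparse] needs when a single vertex lies below. *)
Lemma layer_edges_one (A B : {set 'I_n}) : ~~ both B -> (0 < #|A|)%N ->
  (inner_edges A)%:R + (link_edges A B)%:R <= c * #|A|%:R - (c - 1).
Proof.
move=> /(@link_edges_one A) [k [/andP[lk km] kn knb _]] A0.
have [q [nq q0 ->]] := dens_inv.
have kR : (link_edges A B)%:R <= k%:R :> R by rewrite ler_nat.
suff: (inner_edges A)%:R <= ((n%:R + 1) / 2 - q) * #|A|%:R -
  ((n%:R + 1) / 2 - q - 1) - k%:R.
  by move=> h; rewrite -lerBrDr (le_trans h) ?lerD2l ?lerN2.
have := inner_edgesR A; have := card_layer A.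
have n3 : 3 <= n%:R :> R by rewrite ler_nat.
have {}kn : 2 * k%:R <= n%:R + 1 :> R by rewrite natr1 -natrM ler_nat mul2n.
have {}knb : ~~ both A -> 2 * k%:R <= n%:R :> R.
  by move=> /knb; rewrite -(ler_nat R) -mul2n natrM.
case: (ltnP #|A| p.+2) => [m2 _|m2].
  have {}m2 : #|A|%:R <= n%:R - 2 :> R.
    by rewrite -natrB // ler_nat subn2.
  have {}km : k%:R <= #|A|%:R :> R by rewrite ler_nat.
  have {}A0 : 1 <= #|A|%:R :> R by rewrite ler1n.
  move=> eE; have bA : 0 <= (both A)%:R :> R by rewrite ler0n.
  move: #|A|%:R (inner_edges A)%:R (both A)%:R n%:R k%:R nq n3 kn knb m2 km A0 eE bA
    => m e b N k' nq n3 kn knb m2 km A1 eE bA.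
  have : 0 <= (m - 1) * (N - 2 - m) by apply: mulr_ge0; lra.
  have : 0 <= (m - 1) * (1 - 2 * q) by apply: mulr_ge0; nra.
  nra.
(* If |A| = n - 1 and [A] misses 0 or 1, the slack is half of this quantity; its sign is visible
   from the form q (n - 2)^2. *)
have qN : 0 <= n%:R - 4 + 4 * q.
  have -> : n%:R - 4 + 4 * q = q * (n%:R - 2) ^+ 2.
    by move: n%:R nq => N nq; ring: nq.
  by rewrite mulr_ge0 ?sqr_ge0 // ltW.
rewrite leq_eqVlt => /orP[/eqP mn|mn].
  have bA : both A by apply: contraT => /not_both_card; rewrite mn ltnn.
  rewrite bA mn /=; move: (inner_edges A)%:R n%:R k%:R nq n3 kn qN => e N k' nq n3 kn qN *. lra.
have {mn}m2 : #|A|%:R = n%:R - 1 :> R.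
  have -> : #|A| = p.+2 by lia.
  by rewrite -[in RHS]natr1 addrK.
rewrite m2.
case: (boolP (both A)) knb => [_ _|_ /(_ isT)] /=;
  move: (inner_edges A)%:R n%:R k%:R nq n3 kn qN => e N k' nq n3 kn qN *; lra.
Qed.

Lemma layer_edges_one_both (A B : {set 'I_n}) : ~~ both B -> both A ->
  (inner_edges A)%:R + (link_edges A B)%:R <= c * #|A|%:R - 1.
Proof.
move=> /(@link_edges_one A) [k [/andP[lk km] kn _ kb]] bA.
have F := layer_edges_le A.
have kR : (link_edges A B)%:R <= k%:R :> R by rewrite ler_nat.
(* In the first case at least two vertices lack their link, which saves 2 against
   [layer_edges_le]. *)
case: (kb bA) => [k2|k2].
  have : (k.+2)%:R <= #|A|%:R :> R by rewrite ler_nat.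
  by rewrite -addn2 natrD; lra.
have [q [nq q0 cE]] := dens_inv.
have := inner_edgesR A; rewrite bA /= => eE.
have n3 : 3 <= n%:R :> R by rewrite ler_nat.
have := card_layer A; rewrite leq_eqVlt => /orP[/eqP mn|mn].
  have [b2 [bn nb]] := half_size_bounds.
  have : k%:R <= n%:R - 1 :> R.
    by rewrite lerBrDr natr1 ler_nat; lia.
  move: eE; rewrite cE mn; move: (inner_edges A)%:R n%:R k%:R (link_edges A B)%:R nq kR.
  by move=> e N k' l *; lra.
have : #|A|%:R <= n%:R - 1 :> R by rewrite lerBrDr natr1 ler_nat.
have {}km : k%:R <= #|A|%:R :> R by rewrite ler_nat.
have m2 : 2 <= #|A|%:R :> R by rewrite ler_nat both_card.
move: eE kR km m2; rewrite cE.
move: (inner_edges A)%:R n%:R k%:R nq n3 (link_edges A B)%:R #|A|%:R.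
move=> e N k' nq n3 l m eE kR km m2 mN.
have : 0 <= m * (N - 1 - m) by apply: mulr_ge0; lra.
have : 0 <= m * (1 - 2 * q) by apply: mulr_ge0; nra.
nra.
Qed.
End Layer.

(** * Edge counts in a stack of layers *)

Section Chain.
Variables (R : realFieldType) (p : nat).
Local Notation n := p.+3.
Local Notation c := (dens R n).
Local Notation v1 := (v1 p).
Implicit Types (T : nat -> {set 'I_n}) (X A B : {set 'I_n}).

(** [X] is a virtual layer under the bottom one: empty for the edges of the gadget alone, full when
    the attachments of the bottom vertices are counted as links. *)
Definition below X T i := if i is i'.+1 then T i' else X.

Definition chain_edges X T i : nat :=
  \sum_(l < i) (inner_edges (T l) + link_edges (T l) (below X T l)).

Definition chain_card T i : nat := \sum_(l < i) #|T l|.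

Lemma chain_edgesS X T i : chain_edges X T i.+1 =
  (chain_edges X T i + (inner_edges (T i) + link_edges (T i) (below X T i)))%N.
Proof. by rewrite /chain_edges big_ord_recr. Qed.

Lemma chain_cardS T i : chain_card T i.+1 = (chain_card T i + #|T i|)%N.
Proof. by rewrite /chain_card big_ord_recr. Qed.

Lemma below_card T i : (#|below set0 T i| <= chain_card T i)%N.
Proof. by case: i => [|i] /=; rewrite ?cards0 // chain_cardS leq_addl. Qed.

Lemma layer_le A B :
  (inner_edges A)%:R + (link_edges A B)%:R <= c * #|A|%:R.
Proof.
by apply: le_trans (layer_edges_le R A); rewrite lerD2l ler_nat link_edges_card.
Qed.

Lemma not_both_le1 B : (#|B| <= 1)%N -> ~~ both B.
Proof. by move=> h; apply/negP => /both_card; lia. Qed.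

(** Once two vertices are present, a layer adds at most c per vertex. The layer bringing the second
    vertex is either the first nonempty one, where [inner_edges_le] applies, or lies above a single
    vertex, where [layer_edges_one] saves c - 1. *)
Lemma chain_sparse T i :
  ((chain_card T i <= 1)%N -> chain_edges set0 T i = 0%N) /\
  ((2 <= chain_card T i)%N ->
    (chain_edges set0 T i)%:R <= c * (chain_card T i)%:R - (2 * c - 1)).
Proof.
have c32 := dens_gt R p.
elim: i => [|i [IH1 IH2]]; first by rewrite /chain_card /chain_edges !big_ord0.
rewrite chain_edgesS chain_cardS.
have := below_card T i; move: (below set0 T i) => B Bi.
case: (ltnP 1 (chain_card T i)) => [/[dup] i2 /IH2 le2|i1].
  split=> [|_]; first lia.
  have := layer_le (T i) B; rewrite !natrD; lra.
rewrite IH1 // add0n.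
have nB : ~~ both B by apply: not_both_le1; lia.
have [Ti|Ti] := posnP #|T i|.
  split=> [_|]; last lia.
  by rewrite inner_edges1 ?Ti //; have := link_edges_card (T i) B; lia.
have [i0|i0] := posnP (chain_card T i).
  have -> : B = set0 by apply/eqP; rewrite -cards_eq0; lia.
  rewrite i0 add0n link_edges0 ?inE // addn0.
  by split=> [|A2]; [exact: inner_edges1 | exact: inner_edges_le].
have -> : chain_card T i = 1%N by lia.
split=> [|_]; first lia.
have := layer_edges_one R nB Ti; rewrite !natrD; lra.
Qed.

Lemma chain_edges_le X T i :
  (chain_edges X T i)%:R <= c * (chain_card T i)%:R.
Proof.
elim: i => [|i IH]; first by rewrite /chain_card /chain_edges !big_ord0 mulr0.
rewrite chain_edgesS chain_cardS !natrD.
have := layer_le (T i) (below X T i); lra.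
Qed.

(* Above an empty layer the lowest nonempty layer has no edge downwards and saves
   at least c; this saving is never lost. *)
Lemma chain_edges_gap X T i j : (j < i)%N -> T j = set0 ->
  ((ord0 \in below X T i) || (v1 \in below X T i) ->
    (chain_edges X T i)%:R <= c * (chain_card T i)%:R - c) /\
  (both (below X T i) ->
    (chain_edges X T i)%:R <= c * (chain_card T i)%:R - (c + 1)).
Proof.
move=> ji Tj; have c32 := dens_gt R p.
elim: i ji => // i IH; rewrite ltnS chain_edgesS chain_cardS leq_eqVlt /=.
case/orP => [/eqP <-|/IH {}IH]; first by rewrite Tj /both !inE.
have IH0 := chain_edges_le X T i.
have := layer_le (T i) (below X T i); rewrite !natrD => Fi.
have Tpos : (ord0 \in T i) || (v1 \in T i) -> (0 < #|T i|)%N.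
  by move=> h; apply/card_gt0P; case/orP: h => h; eexists; exact: h.
(* If both of 0, 1 are below, the saving c + 1 persists. If one is, c persists and
   [layer_edges_one_both] adds 1 when the new layer has both. If none is, there are no links and the
   layer alone provides the saving. *)
move: IH; case bB: (both (below X T i)).
  move=> [_ /(_ isT) IH]; split=> _; lra.
move=> [IH _]; case h: ((ord0 \in below X T i) || (v1 \in below X T i)) IH.
  move=> /(_ isT) IH; split=> [_|bT]; first lra.
  have := layer_edges_one_both R (negbT bB) bT; lra.
move=> _; move/norP: (negbT h) => [h0 h1]; rewrite link_edges0 // in Fi *.
split=> [/Tpos T0|bT].
  have := inner_edges_le1 R T0; lra.
have := inner_edges_both R bT; lra.
Qed.

(** * The top layer and the attachments *)

(** Equality for n - 1 vertices: a clique with one link and one attachment per vertex has (n - 1)(n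
    - 2)/2 + 2(n - 1) = c n edges. *)
Lemma cap_le A B : ord0 \notin A ->
  (inner_edges A)%:R + (link_edges A B)%:R + #|A|%:R <= c * #|A|%:R + c.
Proof.
move=> A0; have nA : ~~ both A by rewrite /both (negbTE A0).
have [q [nq q0 ->]] := dens_inv R p.
have : #|A|%:R + 1 <= n%:R :> R by rewrite natr1 ler_nat ltnS not_both_card.
have := inner_edgesR R A; rewrite (negbTE nA) /=.
have : (link_edges A B)%:R <= #|A|%:R :> R by rewrite ler_nat link_edges_card.
have n3 : 3 <= n%:R :> R by rewrite ler_nat.
have := ler0n R #|A|.
move: #|A|%:R (inner_edges A)%:R (link_edges A B)%:R n%:R nq n3
  => m e l N nq n3 m0 lm eE mN.
have : 0 <= (m + 1) * (N - 1 - m) by apply: mulr_ge0; lra.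
have : 0 <= q * (N - (m + 1)) by apply: mulr_ge0; lra.
nra.
Qed.

(** If every vertex of [A] is linked into [B], all links go to 1, so [A] lies in the lower class
    without 0, which has at most n - 2 elements. *)
Lemma link_edges_cap A B : ord0 \notin A -> ord0 \notin B ->
  (link_edges A B < #|A|)%N \/ (#|A| <= p.+1)%N.
Proof.
move=> A0 B0; have [b2 [bn nb]] := half_size_bounds p.
case: (leqP #|A| (link_edges A B)) => [h|]; [right | by left].
have sub : A \subset [set j : 'I_n | (0 < j < half_size p)%N].
  apply/subsetP=> j jA; rewrite inE; apply/andP; split.
    rewrite lt0n; apply: contraNneq A0 => j0.
    by rewrite (_ : ord0 = j) //; apply: val_inj.
  rewrite ltnNge; apply/negP => hj; move: h; rewrite leqNgt => /negP; apply.
  rewrite -sum1_card /link_edges (bigD1 j) //= [X in (_ < X)%N](bigD1 j) //=.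
  have -> : link j = ord0 by rewrite /link ltnNge hj.
  rewrite (negbTE B0) add0n add1n ltnS.
  by apply: leq_sum => i _; case: (_ \in _).
apply: leq_trans (subset_leq_card sub) _.
rewrite -sum1dep_card big_mkcond big_ord_recl /= add0n.
rewrite -[X in (_ <= X)%N]/(p.+2 - 1)%N.
apply: (@leq_trans (\sum_(i < p.+2 | (i < (half_size p).-1)%N) 1)).
  rewrite [X in (_ <= X)%N]big_mkcond; apply: leq_sum => i _ /=.
  by rewrite /bump /= add1n; case: ifP => // h'; rewrite ifT //; lia.
rewrite -(big_ord_widen _ (fun=> 1%N)) ?sum1_card ?card_ord; lia.
Qed.

(** The extra 1 pays for the attachment of vertex 1 in the last full layer: either a link or a
    vertex of the top layer is missing. *)
Lemma cap_le1 A B : ord0 \notin A -> ord0 \notin B ->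
  1 + (inner_edges A)%:R + (link_edges A B)%:R + #|A|%:R <= c * #|A|%:R + c.
Proof.
move=> A0 B0; case: (link_edges_cap A0 B0) => [lA|mn].
  have := cap_le setT A0; rewrite link_edges_setT.
  have : (link_edges A B).+1%:R <= #|A|%:R :> R by rewrite ler_nat.
  rewrite -natr1; lra.
have nA : ~~ both A by rewrite /both (negbTE A0).
have [q [nq q0 ->]] := dens_inv R p.
have := inner_edgesR R A; rewrite (negbTE nA) /=.
have : (link_edges A B)%:R <= #|A|%:R :> R by rewrite ler_nat link_edges_card.
have n3 : 3 <= n%:R :> R by rewrite ler_nat.
have {mn} : #|A|%:R + 2 <= n%:R :> R by rewrite -natrD ler_nat addn2.
have := ler0n R #|A|.
move: #|A|%:R (inner_edges A)%:R (link_edges A B)%:R n%:R nq n3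
  => m e l N nq n3 m0 mN lm eE.
have : 0 <= (m + 1) * (N - 2 - m) by apply: mulr_ge0; lra.
have : 0 <= q * (N - (m + 1)) by apply: mulr_ge0; lra.
have : 0 <= (m + 1) * (1 - 2 * q) by apply: mulr_ge0; nra.
nra.
Qed.

(** All attachments are included: [setT] supplies those of the bottom layer, [v1 \in T l] and [#|A|]
    the others. *)
Definition capped_edges T l A : nat :=
  (chain_edges setT T l.+1 + (v1 \in T l) +
   (inner_edges A + link_edges A (T l) + #|A|))%N.

Lemma capped_edges_le T l A : ord0 \notin A ->
  (capped_edges T l A)%:R <= c * (chain_card T l.+1 + #|A|)%:R + (c + 1).
Proof.
move=> A0; have := cap_le (T l) A0; have := chain_edges_le setT T l.+1.
have : (v1 \in T l)%:R <= 1 :> R by case: (_ \in _); rewrite ?ler01.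
rewrite /capped_edges !natrD; lra.
Qed.

Lemma capped_edges_gap T l A j : ord0 \notin A -> (j <= l)%N -> T j = set0 ->
  (capped_edges T l A)%:R <= c * (chain_card T l.+1 + #|A|)%:R.
Proof.
move=> A0 jl Tj; have [gap1 gap2] := chain_edges_gap setT (jl : (j < l.+1)%N) Tj.
have F := chain_edges_le setT T l.+1.
have F1 := layer_edges_le R A; have F2 := cap_le (T l) A0.
rewrite /capped_edges !natrD; move: gap1 gap2; rewrite /= /both.
(* The excess to cancel is c from the top layer and 1 from vertex 1. Both present: c + 1 is saved.
   Only 0: c is saved and vertex 1 has no attachment. Only 1: c is saved and [cap_le1] gives 1.
   Neither: the top layer has no links and obeys [layer_edges_le]. *)
case h0: (ord0 \in T l); case h1: (v1 \in T l) => /=.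
- by move=> _ /(_ isT); lra.
- by move=> /(_ isT); lra.
- by move=> /(_ isT); have := cap_le1 A0 (negbT h0); lra.
- by move=> _ _; rewrite link_edges0 ?h0 ?h1 //; lra.
Qed.

End Chain.

(** * Bounding the 2-density through an orientation of the edges *)

Definition arcs (V : finType) (D : rel V) (S : {set V}) : nat :=
  \sum_(x in S) \sum_(y in S) D x y.

Lemma sum_eq_mem (T : finType) (A : {set T}) (x : T) :
  (\sum_(y in A) (x == y) = (x \in A))%N.
Proof.
case: (boolP (x \in A)) => xA.
  by rewrite (bigD1 x) //= eqxx big1 // => y /andP[_ /negbTE]; rewrite eq_sym => ->.
by apply: big1 => y yA; case: eqP xA yA => // -> /negbTE ->.
Qed.

Section SymmetricClosure.
Variables (V : finType) (D : rel V).
Hypothesis D_irr : irreflexive D.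

Fact sym_closure_sym : symmetric (fun x y => D x y || D y x).
Proof. by move=> x y; rewrite orbC. Qed.

Fact sym_closure_irr : irreflexive (fun x y => D x y || D y x).
Proof. by move=> x; rewrite D_irr. Qed.

Definition sym_graph : sgraph := SGraph sym_closure_sym sym_closure_irr.

Lemma card_subgraph_edges (H : {set sym_graph} * {set {set sym_graph}}) :
  is_subgraph H -> (#|H.2| <= arcs D H.1)%N.
Proof.
case: H => S F /andP[/= /subsetP FE /forall_inP FS].
pose A := [set q : V * V | [&& q.1 \in S, q.2 \in S & D q.1 q.2]].
have -> : arcs D S = #|A|.
  rewrite /arcs pair_big_dep /= -sum1dep_card big_mkcond [RHS]big_mkcond /=.
  by apply: eq_bigr => q _; case: (_ \in _); case: (_ \in _) => //=; case: D.
apply: leq_trans (leq_imset_card (fun q : V * V => [set q.1; q.2]) A).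
apply: subset_leq_card; apply/subsetP => e eF.
have /imsetP[q] := FE e eF; rewrite inE /= => qD eE.
have := FS e eF; rewrite eE => /subsetP qS.
have q1 : q.1 \in S by apply: qS; rewrite !inE eqxx.
have q2 : q.2 \in S by apply: qS; rewrite !inE eqxx orbT.
case/orP: qD => qD.
  by apply/imsetP; exists q; rewrite ?inE ?q1 ?q2.
by apply/imsetP; exists (q.2, q.1); rewrite ?inE /= ?q1 ?q2 // setUC.
Qed.

Lemma m2_sym_graph_le (R : realFieldType) (d : R) :
  (forall S : {set V}, (3 <= #|S|)%N ->
    (arcs D S)%:R - 1 <= d * (#|S|%:R - 2)) ->
  (3 <= #|V|)%N -> m2 R sym_graph <= d.
Proof.
move=> dS V3.
have le_d (H : {set sym_graph} * {set {set sym_graph}}) :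
    is_subgraph H -> (3 <= #|H.1|)%N -> density2 R H <= d.
  move=> sH H3; rewrite /density2 ler_pdivrMr; last by rewrite subr_gt0 ltr_nat.
  have h := dS H.1 H3; apply: le_trans h; rewrite lerD2r ler_nat.
  exact: card_subgraph_edges.
rewrite /m2; elim/big_ind: _ => [|x y xd yd|H /andP[sH H3]]; last exact: le_d.
  apply: le_d; last by rewrite cardsT.
  by rewrite /is_subgraph subxx; apply/forall_inP => e _; apply: subsetT.
by rewrite ge_max xd.
Qed.

End SymmetricClosure.

(** * Copies of a gadget attached to common roots *)

Section Amplification.
Variables (W : finType) (E : rel W) (P : {set W}) (N : nat).
Hypothesis E_irr : irreflexive E.
Local Notation vert := ('I_N + {ffun W -> 'I_N} * W)%type.

(** Copies are indexed by all maps [f] into the roots, but only those with [f] injective are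
    attached, each port [w] to [f w]. Arcs leave the copies, so they can be counted copy by copy. *)
Definition amp_arc (x y : vert) : bool :=
  match x, y with
  | inr (f, w), inr (g, w') => (f == g) && E w w'
  | inr (f, w), inl i => [&& injectiveb f, w \in P & f w == i]
  | _, _ => false
  end.

Fact amp_arc_irr : irreflexive amp_arc.
Proof. by case=> [//|[f w]] /=; rewrite E_irr andbF. Qed.

Definition amp_graph : sgraph := sym_graph amp_arc_irr.

Definition amp_roots (S : {set vert}) : {set 'I_N} := [set i | inl i \in S].
Definition amp_part (S : {set vert}) (f : {ffun W -> 'I_N}) : {set W} :=
  [set w | inr (f, w) \in S].
Definition amp_pend (S : {set vert}) (f : {ffun W -> 'I_N}) : nat :=
  \sum_(w in amp_part S f) \sum_(i in amp_roots S)
    [&& injectiveb f, w \in P & f w == i].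

Lemma sum_amp (S : {set vert}) (F : vert -> nat) :
  (\sum_(x in S) F x = \sum_(i in amp_roots S) F (inl i) +
    \sum_f \sum_(w in amp_part S f) F (inr (f, w)))%N.
Proof.
rewrite big_sumType /=; congr addn; first by apply: eq_bigl => i; rewrite inE.
rewrite pair_big_dep /=; apply: eq_big => [[f w]|[f w] _] //=.
by rewrite inE.
Qed.

Lemma card_amp (S : {set vert}) :
  #|S| = (#|amp_roots S| + \sum_f #|amp_part S f|)%N.
Proof.
rewrite -sum1_card sum_amp sum1_card; congr addn.
by apply: eq_bigr => f _; rewrite sum1_card.
Qed.

Lemma arcs_amp (S : {set vert}) :
  arcs amp_arc S = (\sum_f (arcs E (amp_part S f) + amp_pend S f))%N.
Proof.
rewrite /arcs /amp_pend sum_amp big1 ?add0n => [|i _]; last by rewrite big1.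
apply: eq_bigr => f _; rewrite -big_split /=; apply: eq_bigr => w _.
rewrite sum_amp addnC; congr addn.
rewrite (bigD1 f) //= [X in (_ + X)%N]big1 ?addn0.
  by apply: eq_bigr => w' _; rewrite eqxx.
by move=> g gf; apply: big1 => w' _; rewrite eq_sym (negbTE gf).
Qed.

Lemma amp_pend_le (S : {set vert}) f : (amp_pend S f <= #|amp_part S f :&: P|)%N.
Proof.
rewrite -sum1_card (eq_bigl (fun w => (w \in amp_part S f) && (w \in P))); last first.
  by move=> w; rewrite in_setI.
rewrite [X in (_ <= X)%N]big_mkcondr; apply: leq_sum => w _ /=.
case: (w \in P); last by rewrite big1 // => i _; rewrite andbF.
case: (injectiveb f); last by rewrite big1.
by rewrite /= sum_eq_mem; case: (_ \in _).
Qed.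

(** An attached copy has an injective [f], so it sends at most one edge to each root. *)
Lemma amp_pend_le_roots (S : {set vert}) f : (amp_pend S f <= #|amp_roots S|)%N.
Proof.
rewrite /amp_pend exchange_big -sum1_card; apply: leq_sum => i _ /=.
case: (boolP (injectiveb f)) => [/injectiveP fi|_]; last by rewrite big1.
case: (pickP (fun w => f w == i)) => [w /eqP fw|no]; last first.
  by rewrite big1 // => w _; rewrite no !andbF.
apply: (@leq_trans (\sum_(w' in amp_part S f) (w == w')%N)).
  apply: leq_sum => w' _ /=; rewrite -fw (inj_eq fi) eq_sym.
  by case: (_ \in _); case: eqP.
by rewrite sum_eq_mem; case: (_ \in _).
Qed.

Lemma arcs_le1 (S : {set W}) : (#|S| <= 1)%N -> arcs E S = 0%N.
Proof.
move=> S1; rewrite /arcs big1 // => x xS; rewrite big1 // => y yS.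
by move/card_le1_eqP: S1 => /(_ x y xS yS) ->; rewrite E_irr.
Qed.

Lemma arcs_le (R : realFieldType) (d : R) (S : {set W}) : 1 <= d ->
  ((2 <= #|S|)%N -> (arcs E S)%:R <= d * (#|S|%:R - 2) + 1) ->
  (0 < #|S|)%N -> (arcs E S)%:R <= d * (#|S|%:R - 1).
Proof.
move=> d1 sparse.
case: (ltnP 1 #|S|) => [S2 _|S1 S0].
  by have := sparse S2; lra.
by rewrite arcs_le1 // mulr_ge0 ?subr_ge0 ?ler1n //; lra.
Qed.

Lemma amp_sparse (R : realFieldType) (d : R) (S : {set vert}) : 1 <= d ->
  (forall A : {set W}, (arcs E A + #|A :&: P|)%:R <= d * #|A|%:R) ->
  (forall A : {set W}, (2 <= #|A|)%N ->
    (arcs E A)%:R <= d * (#|A|%:R - 2) + 1) ->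
  (3 <= #|S|)%N ->
  (arcs amp_arc S)%:R - 1 <= d * (#|S|%:R - 2).
Proof.
rewrite card_amp arcs_amp => d1 sparse_pend sparse S3.
pose s f := #|amp_part S f|.
pose e f := (arcs E (amp_part S f) + amp_pend S f)%N.
rewrite -[(\sum_f #|_|)%N]/(\sum_f s f)%N in S3 *.
rewrite -[(\sum_f (_ + _))%N]/(\sum_f e f)%N.
have eE f : e f = (arcs E (amp_part S f) + amp_pend S f)%N by [].
clearbody e.
have e_le f : (e f)%:R <= d * (s f)%:R.
  apply: le_trans (sparse_pend (amp_part S f)); rewrite eE ler_nat leq_add2l.
  exact: amp_pend_le.
have sum_le (Q : pred {ffun W -> 'I_N}) :
    (\sum_(f | Q f) e f)%N%:R <= d * (\sum_(f | Q f) s f)%N%:R.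
  by rewrite !natr_sum mulr_sumr; apply: ler_sum => f _; exact: e_le.
(* Two roots make up for the subtracted 2, and every copy costs at most d per vertex. *)
case: (ltnP 1 #|amp_roots S|) => [r2|r1].
  have : 2 <= #|amp_roots S|%:R :> R by rewrite ler_nat.
  have := sum_le predT; rewrite natrD => h r2'.
  have : d * 2 <= d * #|amp_roots S|%:R by rewrite ler_wpM2l //; lra.
  rewrite mulrBr mulrDr; lra.
have [f sf] : exists f, (0 < s f)%N.
  case: (pickP (fun f => 0 < s f)%N) => [f ?|no]; first by exists f.
  move: S3; rewrite big1 ?addn0; first by lia.
  by move=> f _; apply/eqP; rewrite -leqn0 leqNgt no.
have e_le1 g : (0 < s g)%N ->
    (e g)%:R <= d * ((s g)%:R - 1) + #|amp_roots S|%:R.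
  move=> sg; rewrite eE natrD; have := arcs_le d1 (sparse _) sg.
  have : (amp_pend S g)%:R <= #|amp_roots S|%:R :> R.
    by rewrite ler_nat amp_pend_le_roots.
  rewrite /s; lra.
have rest : (\sum_(g | g != f) e g)%N%:R <= d * (\sum_(g | g != f) s g)%N%:R.
  exact: sum_le.
have split_sum (F : {ffun W -> 'I_N} -> nat) :
  (\sum_g F g = F f + \sum_(g | g != f) F g)%N by rewrite (bigD1 f).
rewrite !split_sum in S3 *.
(* With one root, that root and the saving d of the nonempty copy [f] make up for 2d; the one
   attachment of [f] is offset by the subtracted 1. *)
have [r0|r0] := posnP #|amp_roots S|; last first.
  have r1' : #|amp_roots S| = 1%N by lia.
  have := e_le1 f sf; rewrite r1' !natrD; lra.
rewrite r0 in e_le1 S3 *.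
(* Without roots, two nonempty copies save d each; a lone copy is covered by its own sparsity. *)
case: (pickP (fun g => (g != f) && (0 < s g)%N)) => [g /andP[gf sg]|no].
  have : (\sum_(h | (h != f) && (h != g)) e h)%N%:R <=
    d * (\sum_(h | (h != f) && (h != g)) s h)%N%:R by exact: sum_le.
  have split2 (F : {ffun W -> 'I_N} -> nat) : (\sum_(h | h != f) F h =
    F g + \sum_(h | (h != f) && (h != g)) F h)%N by rewrite (bigD1 g).
  rewrite !split2 !natrD.
  have := e_le1 f sf; have := e_le1 g sg.
 lra.
have s0 g : g != f -> s g = 0%N.
  by move=> gf; have := no g; rewrite gf /= => /negbT; rewrite -eqn0Ngt => /eqP.
have e0 g : g != f -> e g = 0%N.
  move=> gf; have := e_le g; rewrite s0 // mulr0 => h.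
  by apply/eqP; rewrite -(eqr_nat R) eq_le h ler0n.
have e_rest : (\sum_(g | g != f) e g = 0)%N by exact: big1.
have s_rest : (\sum_(g | g != f) s g = 0)%N by exact: big1.
rewrite e_rest s_rest !addn0 !add0n in S3 *.
have : (e f <= arcs E (amp_part S f))%N.
  by rewrite eE; have := amp_pend_le_roots S f; rewrite r0; lia.
rewrite -(ler_nat R); have := sparse (amp_part S f) (ltnW S3).
rewrite -/(s f); lra.
Qed.

Lemma m2_amp_graph_le (R : realFieldType) (d : R) : 1 <= d ->
  (forall A : {set W}, (arcs E A + #|A :&: P|)%:R <= d * #|A|%:R) ->
  (forall A : {set W}, (2 <= #|A|)%N ->
    (arcs E A)%:R <= d * (#|A|%:R - 2) + 1) ->
  (3 <= N)%N -> m2 R amp_graph <= d.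
Proof.
move=> d1 pend sp N3; apply: m2_sym_graph_le => [S|]; first exact: amp_sparse.
by rewrite card_sum card_ord; lia.
Qed.

(** * Chromatic number of the amplified graph *)

Section Colorings.
Variable n : nat.

Lemma amp_graph_colorable (g : W -> 'I_n) :
  (forall x y, E x y -> g x != g y) -> colorable amp_graph n.+1.
Proof.
move=> gE; pose h (x : amp_graph) : 'I_n.+1 :=
  match (x : vert) with inl _ => ord_max | inr (_, w) => lift ord_max (g w) end.
have hE x y : amp_arc x y -> h x != h y.
  case: x y => [//|[f w]] [i _|[f' w'] /andP[_ /gE]] /=.
    by rewrite eq_sym neq_lift.
  by rewrite (inj_eq lift_inj).
apply/existsP; exists (finfun h).
apply/forallP => x; apply/forallP => y; apply/implyP; rewrite !ffunE.
by case/orP => /hE //; rewrite eq_sym.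
Qed.

Lemma monochromatic_injection (f : 'I_N -> 'I_n) : (n * #|W| < N)%N ->
  exists a, exists2 t : W -> 'I_N, injective t & forall w, f (t w) = a.
Proof.
move=> nN.
have [a aW] : exists a, (#|W| <= #|[set i | f i == a]|)%N.
  apply/existsP; apply: contraLR nN => /existsPn no; rewrite -leqNgt.
  rewrite -[X in (X <= _)%N](card_ord N) -sum1_card (partition_big f predT) //=.
  rewrite -[X in (_ <= X * _)%N]card_ord -sum_nat_const.
  apply: leq_sum => a _; rewrite sum1dep_card ltnW // ltnNge.
  exact: no.
exists a; exists (fun w => enum_val (widen_ord aW (enum_rank w))).
  by move=> w w' /enum_val_inj /(congr1 val) /= /val_inj /enum_rank_inj.
by move=> w; apply/eqP; have := enum_valP (widen_ord aW (enum_rank w)); rewrite inE.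
Qed.

(** In the copy indexed by an injection into roots of one colour a, every port is adjacent to colour
    a, yet some port must have it. *)
Lemma amp_graph_not_colorable : (n * #|W| < N)%N ->
  (forall g : W -> 'I_n, (forall x y, E x y -> g x != g y) ->
    forall a, exists2 w, w \in P & g w = a) ->
  ~~ colorable amp_graph n.
Proof.
move=> nN full; apply/negP => /existsP[f /forallP fE].
have {}fE x y : amp_arc x y -> f x != f y.
  by move=> xy; move/forallP: (fE x) => /(_ y) /implyP; apply; rewrite /= xy.
have [a [t t_inj ft]] := monochromatic_injection (fun i => f (inl i)) nN.
have [|w wP fw] := full (fun w => f (inr (finfun t, w))) _ a.
  by move=> x y xy; apply: fE; rewrite /= eqxx.
have /fE : amp_arc (inr (finfun t, w)) (inl (t w)).
  rewrite /= wP ffunE eqxx andbT /= andbT.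
  by apply/injectiveP => x y; rewrite !ffunE; exact: t_inj.
by rewrite fw ft eqxx.
Qed.

Lemma chromatic_number_amp_graph (g : W -> 'I_n) :
  (forall x y, E x y -> g x != g y) -> (n * #|W| < N)%N ->
  (forall h : W -> 'I_n, (forall x y, E x y -> h x != h y) ->
    forall a, exists2 w, w \in P & h w = a) ->
  chromatic_number amp_graph = n.+1.
Proof.
move=> gE nN full; rewrite /chromatic_number.
case: ex_minnP => m mC mmin; apply/eqP.
rewrite eqn_leq mmin ?(amp_graph_colorable gE) //=.
rewrite ltnNge; apply: contra (amp_graph_not_colorable nN full) => mn.
case/existsP: mC => f /forallP fE; apply/existsP.
exists [ffun x => widen_ord mn (f x)].
apply/forallP => x; apply/forallP => y; apply/implyP => xy; rewrite !ffunE.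
move/forallP: (fE x) => /(_ y); rewrite xy /=.
by apply: contra => /eqP /(congr1 val) /= h; apply/eqP/val_inj.
Qed.

End Colorings.
End Amplification.

(** * The gadget and its edge counts *)

Section Gadget.
Variables (p l : nat).
Local Notation n := p.+3.
Local Notation v1 := (v1 p).
Local Notation W := ('I_l.+2 * 'I_n)%type.
Implicit Types (x y : W) (S : {set W}).

(* Vertex 0 of the top layer is isolated, which leaves an (n - 1)-clique. *)
Definition gadget_arc x y : bool :=
  ~~ ((x.1 == ord_max) && (x.2 == ord0)) &&
  ((x.1 == y.1) && inner x.2 y.2 || (x.1 == y.1.+1 :> nat) && (y.2 == link x.2)).

Definition ports : {set W} :=
  [set x : W | [|| x.1 == 0 :> nat, (x.1 == l :> nat) && (x.2 == v1)
             | (x.1 == ord_max) && (x.2 != ord0)]].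

Lemma gadget_arc_irr : irreflexive gadget_arc.
Proof.
by move=> x; rewrite /gadget_arc /inner ltnn /= andbF ltn_eqF ?andbF.
Qed.

(** Indexed by [nat] to serve as the sequence [T] of a chain; it is evaluated only up to [l.+1],
    where [inord] is faithful. *)
Definition layer S (i : nat) : {set 'I_n} := [set j | (inord i, j) \in S].

Definition top_layer S : {set 'I_n} := layer S l.+1 :\ ord0.

Lemma sum_layers S (F : W -> nat) :
  (\sum_(x in S) F x = \sum_(i < l.+2) \sum_(j in layer S i) F (i, j))%N.
Proof.
rewrite pair_big_dep /=; apply: eq_big => [[i j]|[i j] _] //=.
by rewrite inE inord_val.
Qed.

Lemma card_layers S : #|S| = (chain_card (layer S) l.+1 + #|layer S l.+1|)%N.
Proof.
rewrite -sum1_card sum_layers big_ord_recr /=; congr addn; last by rewrite sum1_card.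
by apply: eq_bigr => i _; rewrite sum1_card.
Qed.

Lemma out_arcs_le S (i : 'I_l.+2) (j : 'I_n) :
  (\sum_(y in S) ((i == y.1) && inner j y.2 || (i == y.1.+1 :> nat) && (y.2 == link j))
   <= \sum_(j' in layer S i) inner j j' + (link j \in below set0 (layer S) i))%N.
Proof.
apply: (@leq_trans (\sum_(y in S) (((i == y.1) && inner j y.2) +
   ((i == y.1.+1 :> nat) && (y.2 == link j))))%N).
  by apply: leq_sum => y _; do 2!case: (_ && _).
rewrite big_split /= !sum_layers; apply: leq_add.
  rewrite (bigD1 i) //= [X in (_ + X <= _)%N]big1 ?addn0 => [|i' ii'].
    by apply: leq_sum => j' _; rewrite eqxx.
  by apply: big1 => j' _; rewrite eq_sym (negbTE ii').
case: i => [[|i] /= il].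
  by rewrite big1 // => i' _; rewrite big1.
rewrite (bigD1 (Ordinal (ltnW il))) //= [X in (_ + X <= _)%N]big1 ?addn0 => [|i' ii'].
  under eq_bigr => j' _ do rewrite eqxx /= eq_sym.
  by rewrite sum_eq_mem.
apply: big1 => j' _; rewrite eqSS; case: eqP => // e; case/eqP: ii'.
exact: val_inj.
Qed.

Lemma arcs_gadget_le S : (arcs gadget_arc S <= chain_edges set0 (layer S) l.+1 +
  (inner_edges (top_layer S) + link_edges (top_layer S) (layer S l)))%N.
Proof.
rewrite /arcs sum_layers big_ord_recr; apply: leq_add.
  apply: leq_sum => i _; rewrite -big_split; apply: leq_sum => j _ /=.
  apply: leq_trans (out_arcs_le S (widen_ord (leqnSn _) i) j); apply: leq_sum => y _.
  by rewrite /gadget_arc; case: (~~ _).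
rewrite -big_split /= big_mkcond [X in (_ <= X)%N]big_mkcond.
apply: leq_sum => j _; rewrite in_setD1;
case: (boolP (j \in layer S l.+1)) => [jS|]; last by rewrite andbF.
rewrite andbT; case: (eqVneq j ord0) => [->|j0].
  by rewrite big1 // => y _; rewrite /gadget_arc /= !eqxx.
have -> : (\sum_(j' in top_layer S) inner j j' = \sum_(j' in layer S l.+1) inner j j')%N.
  rewrite big_mkcond [RHS]big_mkcond; apply: eq_bigr => j' _.
  by rewrite in_setD1; case: (eqVneq j' ord0) => [->|//]; rewrite /inner ltn0 if_same.
apply: leq_trans (out_arcs_le S ord_max j); apply: leq_sum => y _.
by rewrite /gadget_arc; case: (~~ _).
Qed.

Lemma ports_le S : (#|S :&: ports| <=
  #|layer S 0| + (v1 \in layer S l) + #|top_layer S|)%N.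
Proof.
rewrite -sum1_card (eq_bigl (fun x => (x \in S) && (x \in ports))); last first.
  by move=> x; rewrite in_setI.
rewrite big_mkcondr sum_layers.
apply: (@leq_trans (\sum_(i < l.+2) \sum_(j in layer S i)
  ((i == 0 :> nat) + ((i == l :> nat) && (v1 == j)) +
   ((i == ord_max) && (j != ord0))))%N).
  apply: leq_sum => i _; apply: leq_sum => j _; rewrite inE /= [v1 == j]eq_sym.
  by case: (_ == 0 :> nat); case: (_ && _); case: (_ && _).
under eq_bigr => i _ do rewrite !big_split /=.
rewrite !big_split /=; apply: leq_add; first apply: leq_add.
- rewrite big_ord_recl /= [X in (_ + X <= _)%N]big1 ?addn0 => [|i _]; last by rewrite big1.
  by rewrite sum1_card.
- rewrite (bigD1 (widen_ord (leqnSn _) ord_max)) //= [X in (_ + X <= _)%N]big1 ?addn0 => [|i il].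
    by under eq_bigr => j _ do rewrite eqxx /=; rewrite sum_eq_mem.
  apply: big1 => j _; case: eqP => // e; case/eqP: il; exact: val_inj.
rewrite (bigD1 ord_max) //= [X in (_ + X <= _)%N]big1 ?addn0 => [|i il]; last first.
  by apply: big1 => j _; rewrite (negbTE il).
rewrite -sum1_card big_mkcond [X in (_ <= X)%N]big_mkcond; apply: leq_sum => j _.
by rewrite in_setD1 eqxx /=; case: (_ == _); case: (_ \in _).
Qed.

Lemma chain_edges_setT (T : nat -> {set 'I_n}) i :
  chain_edges setT T i.+1 = (chain_edges set0 T i.+1 + #|T 0|)%N.
Proof.
rewrite /chain_edges !big_ord_recl /= link_edges_setT link_edges0 ?inE //.
by rewrite addn0 addnAC.
Qed.

Lemma top_layer_card S : (#|top_layer S| <= #|layer S l.+1|)%N.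
Proof. by rewrite subset_leq_card ?subsetDl. Qed.

Lemma ord0_top_layer S : ord0 \notin top_layer S.
Proof. by rewrite !inE eqxx. Qed.

Section Density.
Variable R : realFieldType.
Local Notation c := (dens R n).

(** Restoring the edges at vertex 0 of the top layer can only add to the count, so the top becomes
    one more ordinary layer of a chain. *)
Lemma gadget_sparse S : (2 <= #|S|)%N ->
  (arcs gadget_arc S)%:R <= c * (#|S|%:R - 2) + 1.
Proof.
move=> S2; have [_ sp] := chain_sparse R (layer S) l.+2.
have : (chain_edges set0 (layer S) l.+2)%:R <= c * #|S|%:R - (2 * c - 1).
  by rewrite card_layers -chain_cardS in S2 *; exact: sp.
suff : (arcs gadget_arc S <= chain_edges set0 (layer S) l.+2)%N.
  rewrite -(ler_nat R) mulrBr; lra.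
apply: leq_trans (arcs_gadget_le S) _; rewrite [X in (_ <= X)%N]chain_edgesS leq_add2l.
have /subsetP sub : top_layer S \subset layer S l.+1 by apply: subsetDl.
apply: leq_add.
  rewrite /inner_edges big_mkcond [X in (_ <= X)%N]big_mkcond; apply: leq_sum => i _.
  case: ifP => // /sub ->.
  rewrite big_mkcond [X in (_ <= X)%N]big_mkcond; apply: leq_sum => j _.
  by case: ifP => // /sub ->.
rewrite /link_edges big_mkcond [X in (_ <= X)%N]big_mkcond; apply: leq_sum => i _.
by case: ifP => // /sub ->.
Qed.

(** The excess c + 1 can arise only if [S] meets all l + 1 full layers; then |S| >= l + 1 and the
    [eps] term absorbs it. *)
Lemma gadget_sparse_ports (eps : R) S : 0 <= eps -> c + 1 <= eps * c * l.+1%:R ->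
  (arcs gadget_arc S + #|S :&: ports|)%:R <= (1 + eps) * c * #|S|%:R.
Proof.
move=> eps0 long; have c32 := dens_gt R p.
have : (arcs gadget_arc S + #|S :&: ports| <=
    capped_edges (layer S) l (top_layer S))%N.
  apply: leq_trans (leq_add (arcs_gadget_le S) (ports_le S)) _.
  rewrite /capped_edges chain_edges_setT.
  by move: (chain_edges _ _ _) #|_| #|_| (nat_of_bool _) => a b d e; lia.
rewrite -(ler_nat R) => /le_trans; apply.
have cardS : (chain_card (layer S) l.+1 + #|top_layer S| <= #|S|)%N.
  by rewrite card_layers leq_add2l top_layer_card.
have cS : c * (chain_card (layer S) l.+1 + #|top_layer S|)%:R <= c * #|S|%:R.
  by rewrite ler_wpM2l ?ler_nat //; lra.
have epsS : 0 <= eps * c * #|S|%:R by apply: mulr_ge0 => //; apply: mulr_ge0 => //; lra.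
rewrite -mulrA mulrDl mul1r mulrA.
case: (pickP (fun j : 'I_l.+1 => layer S j == set0)) => [j /eqP Sj|full].
  have jl : (j <= l)%N by rewrite -ltnS.
  have := capped_edges_gap R (ord0_top_layer S) jl Sj; lra.
have lS : l.+1%:R <= #|S|%:R :> R.
  rewrite ler_nat; apply: leq_trans cardS; apply: leq_trans (leq_addr _ _).
  rewrite -[X in (X <= _)%N]card_ord -sum1_card; apply: leq_sum => j _.
  by rewrite card_gt0 full.
have : eps * c * l.+1%:R <= eps * c * #|S|%:R.
  by apply: ler_wpM2l => //; apply: mulr_ge0 => //; lra.
have := capped_edges_le R (layer S) l (ord0_top_layer S); lra.
Qed.

End Density.

(** * Colourings of the gadget *)

(** The first element of the upper linking class. Exchanging its colour with that of vertex 1 in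
    every second layer makes all links proper; as the exchange is an involution, one check serves
    both parities. *)
Definition swap_pt : 'I_n := inord (half_size p).

Definition layer_color (x : W) : 'I_n :=
  if odd x.1 then tperm v1 swap_pt x.2 else x.2.

Lemma swap_link (j : 'I_n) : tperm v1 swap_pt j != link j.
Proof.
have [b2 [bn nb]] := half_size_bounds p.
have sv : swap_pt = half_size p :> nat by rewrite inordK //; lia.
rewrite /link; case: ltnP => jb.
  rewrite -[X in _ != X](tpermR v1 swap_pt) (inj_eq perm_inj).
  by apply: contraTneq jb => ->; rewrite sv ltnn.
have t0 : tperm v1 swap_pt ord0 = ord0.
  by rewrite tpermD // -(inj_eq val_inj) /= ?sv; lia.
rewrite -[X in _ != X]t0 (inj_eq perm_inj).
by apply: contraTneq jb => ->; rewrite -ltnNge (ltn_trans _ b2).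
Qed.

Lemma layer_color_proper x y : gadget_arc x y -> layer_color x != layer_color y.
Proof.
case: x y => [i j] [i' j'] /andP[_ /orP[]] /andP[/eqP /= ii']; rewrite /layer_color /=.
  rewrite -ii' => /andP[jj' _].
  have ne : j != j' by rewrite -(inj_eq val_inj) /= ltn_eqF.
  by case: ifP; rewrite ?(inj_eq perm_inj).
move=> /eqP ->; rewrite ii' /=; case: (odd i') => /=; last exact: swap_link.
by rewrite -(inj_eq (@perm_inj _ (tperm v1 swap_pt))) tpermK swap_link.
Qed.

Lemma inj_hits (f : 'I_n -> 'I_n) a : injective f -> exists j, f j = a.
Proof. by move=> f_inj; exists (invF f_inj a); rewrite f_invF. Qed.

Lemma gadget_full (h : W -> 'I_n) : (forall x y, gadget_arc x y -> h x != h y) ->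
  forall a, exists2 w, w \in ports & h w = a.
Proof.
move=> hE a; case: (pickP (fun w => (w \in ports) && (h w == a))) => [w|no].
  by move=> /andP[wP /eqP]; exists w.
have hP w : w \in ports -> h w != a by move=> wP; have := no w; rewrite wP /= => ->.
have h_inner (i : 'I_l.+2) (j j' : 'I_n) :
    (i, j) != (ord_max, ord0) -> inner j j' -> h (i, j) != h (i, j').
  move=> ij jj'; apply: hE; apply/andP; split; first by move: ij; rewrite xpair_eqE.
  by rewrite /= eqxx jj'.
have h_link (i i' : 'I_l.+2) (j : 'I_n) : (i, j) != (ord_max, ord0) -> i = i'.+1 :> nat ->
    h (i, j) != h (i', link j).
  move=> ij ii'; apply: hE; apply/andP; split; first by move: ij; rewrite xpair_eqE.
  by rewrite /= ii' !eqxx orbT.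
(* A full layer in which 0 and 1 differ shows all n colours, hence also any colour forbidden to
   it. *)
have layer_inj (i : 'I_l.+2) : (i <= l)%N -> h (i, ord0) != h (i, v1) ->
    injective (fun j => h (i, j)).
  move=> il h01; have imax (j : 'I_n) : (i, j) != (ord_max, ord0).
    by rewrite xpair_eqE -(inj_eq val_inj) /= ltn_eqF.
  have lt_ne (j j' : 'I_n) : (j < j')%N -> h (i, j) != h (i, j').
    move=> jj'; case: (eqVneq (j, j') (ord0, v1)) => [[-> ->] //|ne].
    by apply: h_inner => //; rewrite /inner jj'.
  move=> j j' e; case: (ltngtP j j') => [/lt_ne|/lt_ne|/val_inj //].
    by rewrite e eqxx.
  by rewrite e eqxx.
have inK i : (i <= l)%N -> (inord i : 'I_l.+2) = i :> nat.
  by move=> il; rewrite inordK // ltnS leqW.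
(* The forbidden colour is a at the bottom and, higher up, the common colour of 0 and 1 one layer
   below, since each vertex is linked to one of them. *)
have eq01 (i : nat) : (i <= l)%N -> h (inord i, ord0) = h (inord i, v1).
  elim: i => [_|i IH il].
    apply/eqP; apply: contraT => /layer_inj inj0.
    have [|j /eqP] := inj_hits a (inj0 _); first by rewrite inK.
    by rewrite (negbTE (hP _ _)) // inE /= inK.
  apply/eqP; apply: contraT => /layer_inj inj0.
  have [|j /eqP] := inj_hits (h (inord i, v1)) (inj0 _); first by rewrite inK.
  have : h (inord i.+1, j) != h (inord i, link j).
    apply: h_link; last by rewrite !inK // ltnW.
    by rewrite xpair_eqE -(inj_eq val_inj) /= inK // ltn_eqF.
  by rewrite /link; case: ifP => _; rewrite -?(IH (ltnW il)) => /negbTE ->.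
(* The vacant place 0 of the top layer receives the common colour from below, which the links
   exclude from the top. The n values are then distinct, so a occurs, and on a port. *)
pose f (j : 'I_n) := if j == ord0 then h (inord l, ord0) else h (ord_max, j).
have link_ne (j : 'I_n) : j != ord0 -> h (ord_max, j) != h (inord l, ord0).
  move=> j0; have : h (ord_max, j) != h (inord l, link j).
    by apply: h_link; rewrite ?inK // xpair_eqE (negbTE j0) andbF.
  by rewrite /link; case: ifP => _; rewrite -?(eq01 l).
have lt_ne (j j' : 'I_n) : j != ord0 -> (j < j')%N -> h (ord_max, j) != h (ord_max, j').
  move=> j0 jj'; apply: h_inner; first by rewrite xpair_eqE (negbTE j0) andbF.
  by rewrite /inner jj' xpair_eqE (negbTE j0).
have f_inj : injective f.
  move=> j j'; rewrite /f; case: eqVneq => [->|j0]; case: eqVneq => [->|j0'] //.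
  - by move=> /esym /eqP; rewrite (negbTE (link_ne _ _)).
  - by move=> /eqP; rewrite (negbTE (link_ne _ _)).
  case: (ltngtP j j') => [jj'|jj'|/val_inj //] /eqP.
    by rewrite (negbTE (lt_ne _ _ _ _)).
  by rewrite eq_sym (negbTE (lt_ne _ _ _ _)).
have [j] := inj_hits a f_inj; rewrite /f; case: eqVneq => [_|j0] /eqP.
  by rewrite eq01 // (negbTE (hP _ _)) // inE /= inK // eqxx orbT.
by rewrite (negbTE (hP _ _)) // inE /= eqxx j0 !orbT.
Qed.

End Gadget.

(** * The infinite family of graphs *)

Section Family.
Variables (p l : nat).

(** More than n |W| roots for the pigeonhole argument, and at least 3 for the 2-density. *)
Definition family_roots : nat := (p.+3 * (l.+2 * p.+3)).+3.

Definition family : sgraph :=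
  amp_graph (ports p l) family_roots (@gadget_arc_irr p l).

Lemma chromatic_number_family : chromatic_number family = p.+4.
Proof.
apply: chromatic_number_amp_graph (@layer_color_proper p l) _ (@gadget_full p l).
by rewrite card_prod !card_ord /family_roots; lia.
Qed.

Lemma m2_family_le (R : realFieldType) (eps : R) : 0 <= eps ->
  dens R p.+3 + 1 <= eps * dens R p.+3 * l.+1%:R ->
  m2 R family <= (1 + eps) * dens R p.+3.
Proof.
move=> eps0 long; have c32 := dens_gt R p.
have le_c : dens R p.+3 <= (1 + eps) * dens R p.+3 by nra.
apply: m2_amp_graph_le => [|A|A A2|//]; first lra.
  exact: gadget_sparse_ports.
apply: le_trans (gadget_sparse R A2) _; rewrite lerD2r ler_wpM2r //.
by rewrite subr_ge0 ler_nat.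
Qed.

End Family.

Lemma card_family_lt p l l' : (l < l')%N ->
  (#|family p l| < #|family p l'|)%N.
Proof.
move=> ll'; rewrite !card_sum !card_prod !card_ffun !card_prod !card_ord.
have rr : (family_roots p l < family_roots p l')%N.
  by rewrite /family_roots 3!ltnS ltn_pmul2l // ltn_pmul2r.
rewrite -addSn; apply: leq_add => //; apply: leq_mul; last first.
  by rewrite leq_mul2r !ltnS ltnW.
apply: leq_trans (_ : (family_roots p l' ^ (l.+2 * p.+3) <= _)%N).
  by rewrite leq_exp2r // ltnW.
by rewrite leq_pexp2l // leq_mul2r !ltnS ltnW.
Qed.

Theorem theorem1p3 (R : realType) (k : nat) (eps : R) :
  (4 <= k)%N -> 0 < eps ->
  infinitely_many_graphs (fun G : sgraph =>
    chromatic_number G = k /\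
    m2 R G <= (1 + eps) *
      (((k%:R + 1) * (k%:R - 2)) / (2 * (k%:R - 1)))).
Proof.
case: k => [|[|[|[|p]]]] // _ eps0.
have c32 := dens_gt R p; set c := dens R p.+3 in c32.
have ec : 0 < eps * c by apply: mulr_gt0 => //; lra.
have -> : ((p.+4%:R + 1) * (p.+4%:R - 2)) / (2 * (p.+4%:R - 1)) = c :> R.
  rewrite /c /dens -[p.+4%:R]natr1; congr (_ * _ / (_ * _)); ring.
(* From this length on, [eps * c] times the number of full layers is at least c + 1, as
   [m2_family_le] requires. *)
pose l0 := Num.bound ((c + 1) / (eps * c)).
exists (fun i => family p (l0 + i)); split=> [i j ij [f [f_bij _]]|i].
  have := bij_eq_card f_bij.
  case: (ltngtP i j) => [lt_ij|lt_ji|//] e.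
    by have := @card_family_lt p (l0 + i) (l0 + j); rewrite e ltnn ltn_add2l => /(_ lt_ij).
  by have := @card_family_lt p (l0 + j) (l0 + i); rewrite e ltnn ltn_add2l => /(_ lt_ji).
split; first exact: chromatic_number_family.
apply: m2_family_le; first exact: ltW.
rewrite -/c mulrC -ler_pdivrMr // ltW //.
apply: lt_le_trans (archi_boundP _) _; first by rewrite divr_ge0 ?ltW //; lra.
by rewrite ler_nat leqW // leq_addr.
Qed.
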